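(* Let $m\ge 1$ be an integer and let $a,b$ be positive real numbers. Then the generating function of the generalized harmonic numbers $h_n^{(m)}(a,b)$ of order $m$ has the continued fraction expansion $$\sum_{n=1}^\infty h_n^{(m)}(a,b)x^n=\cfrac{x}{b^m(1-x)-\cfrac{b^{2m}x(1-x)}{(a+b)^m+b^m x-\cfrac{(a+b)^{2m}x}{(2a+b)^m+(a+b)^m x-\cfrac{(2a+b)^{2m}x}{(3a+b)^m+(2a+b)^m x-\ddots}}}}\,,$$ i.e. the continued fraction $a_0+\cfrac{b_1}{a_1+\cfrac{b_2}{a_2+\ddots}}$ with $a_0=0$, $b_1=x$, $a_1=b^m(1-x)$, $b_2=-b^{2m}x(1-x)$, $a_n=\bigl((n-1)a+b\bigr)^m+\bigl((n-2)a+b\bigr)^m x$ for $n\ge 2$, and $b_n=-\bigl((n-2)a+b\bigr)^{2m}x$ for $n\ge 3$.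
   Context: The generalized harmonic numbers of order $m$ are $h_n^{(m)}(a,b)=\sum_{k=1}^n\frac{1}{((k-1)a+b)^m}$ for $n\ge 1$, with $h_0^{(m)}(a,b)=0$. (The sequences of partial denominators $a_n$ and partial numerators $b_n$, which carry an index, are not to be confused with the parameters $a,b$.) Convention on continued fractions: for polynomials $a_n$ ($n\ge 0$), $b_n$ ($n\ge 1$) in $x$, the convergents $P_n/Q_n$ of $a_0+\cfrac{b_1}{a_1+\cfrac{b_2}{a_2+\ddots}}$ are defined by $P_{-1}=1$, $Q_{-1}=0$, $P_0=a_0$, $Q_0=1$, $P_n=a_nP_{n-1}+b_nP_{n-2}$, $Q_n=a_nQ_{n-1}+b_nQ_{n-2}$ ($n\ge 1$). A formal power series $f(x)$ has this continued fraction expansion (written as an equality) if for every $n\ge 0$ the power series expansion at $x=0$ of $P_n(x)/Q_n(x)$ agrees with $f(x)$ up to and including the term in $x^n$, i.e. $P_n/Q_n\equiv f\pmod{x^{n+1}}$; in particular $f=\lim_{n\to\infty}P_n/Q_n$ as formal power series. *)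

(* Defs.v *)
From mathcomp Require Import all_boot all_order all_algebra.
From mathcomp Require Import reals.

Set Implicit Arguments.
Unset Strict Implicit.
Unset Printing Implicit Defensive.

Import Order.TTheory GRing.Theory Num.Theory.
Local Open Scope ring_scope.

(* A formal power series is represented by its sequence of coefficients. *)
Definition fps (F : fieldType) : Type := nat -> F.

Definition fps_mul (F : fieldType) (f g : fps F) : fps F :=
  fun n => \sum_(i < n.+1) f i * g (n - i)%N.

Definition fps_of_poly (F : fieldType) (p : {poly F}) : fps F :=
  fun n => p`_n.

(* Since F[[x]] is an integral domain, such a [g] is unique when it exists.
   [q] may vanish at 0, as long as the fraction p/q has no pole there. *)
Definition is_expansion (F : fieldType) (p q : {poly F}) (g : fps F) : Prop :=
  q != 0 /\ fps_mul (fps_of_poly q) g =1 fps_of_poly p.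

Definition fps_eqmod (F : fieldType) (n : nat) (f g : fps F) : Prop :=
  forall i, (i < n)%N -> f i = g i.

(* The pair (X_(n-1), X_n), where X_(-1) = u, X_0 = v and
   X_n = a_n X_(n-1) + b_n X_(n-2) for n >= 1; the value b_0 is never used. *)
Fixpoint cf_pair (F : fieldType) (a b : nat -> {poly F}) (u v : {poly F})
    (n : nat) : {poly F} * {poly F} :=
  if n is k.+1 then
    let: (y, z) := cf_pair a b u v k in (z, a n * z + b n * y)
  else (u, v).

Definition cf_num (F : fieldType) (a b : nat -> {poly F}) (n : nat) : {poly F} :=
  (cf_pair a b 1 (a 0%N) n).2.

Definition cf_den (F : fieldType) (a b : nat -> {poly F}) (n : nat) : {poly F} :=
  (cf_pair a b 0 1 n).2.

Definition has_cf_expansion (F : fieldType) (f : fps F)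
    (a b : nat -> {poly F}) : Prop :=
  forall n : nat, exists g : fps F,
    is_expansion (cf_num a b n) (cf_den a b n) g /\ fps_eqmod n.+1 g f.

Definition gen_harmonic (F : fieldType) (m : nat) (a b : F) (n : nat) : F :=
  \sum_(1 <= k < n.+1) ((k.-1%:R * a + b) ^+ m)^-1.

Definition gen_harmonic_series (F : fieldType) (m : nat) (a b : F) : fps F :=
  fun n => if n is 0 then 0 else gen_harmonic m a b n.

Definition harmonic_cf_a (F : fieldType) (m : nat) (a b : F) (n : nat)
    : {poly F} :=
  match n with
  | 0 => 0
  | 1 => b ^+ m *: (1 - 'X)
  | _ => (((n - 1)%:R * a + b) ^+ m)%:P + ((n - 2)%:R * a + b) ^+ m *: 'X
  end.

(* The index starts at 1; the value at 0 is a placeholder. *)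
Definition harmonic_cf_b (F : fieldType) (m : nat) (a b : F) (n : nat)
    : {poly F} :=
  match n with
  | 0 => 0
  | 1 => 'X
  | 2 => - (b ^+ (2 * m) *: ('X * (1 - 'X)))
  | _ => - (((n - 2)%:R * a + b) ^+ (2 * m) *: 'X)
  end.

(* Main.v *)
(** By induction, for [n >= 1] the convergents are
    [Q_n = (1 - x) E_n] and [P_n = E_n \sum_(k < n) x^(k+1) / e_k], where
    [e_k = (k a + b)^m] and [E_n = \prod_(k < n) e_k].  Dividing by [1 - x]
    turns coefficients into partial sums, so [P_n / Q_n] agrees with the series
    of harmonic numbers up to [x^n]. *)

Require Import Defs.
From mathcomp Require Import all_boot all_order all_algebra.
From mathcomp Require Import reals.
From mathcomp Require Import ring.

Import Order.TTheory GRing.Theory Num.Theory.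
Local Open Scope ring_scope.

Lemma cf_pairS (F : fieldType) (a b : nat -> {poly F}) (u v : {poly F}) n :
  (cf_pair a b u v n.+2).2 =
  a n.+2 * (cf_pair a b u v n.+1).2 + b n.+2 * (cf_pair a b u v n).2.
Proof. by rewrite /=; case: (cf_pair a b u v n). Qed.

(** Multiplying by [1 - 'X] takes differences of consecutive coefficients, which undoes partial
    summation. *)
Lemma is_expansion_partial_sums (F : fieldType) (c : F) (p : {poly F}) :
  c != 0 ->
  is_expansion p (c *: (1 - 'X)) (fun n => c^-1 * \sum_(k < n.+1) p`_k).
Proof.
move=> c0; split.
  by rewrite scale_poly_eq0 negb_or c0 -opprB oppr_eq0 -polyC1 polyXsubC_eq0.
move=> [|n]; rewrite /fps_mul /fps_of_poly.
  by rewrite !big_ord1 /= !coefE /= subr0 mulr1 mulVKf.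
rewrite 2!big_ord_recl [X in _ + (_ + X)]big1 => [|i _]; last first.
  by rewrite !coefE /= subr0 mulr0 mul0r.
rewrite !coefE /= /bump /= !subn0 subn1 /= (big_ord_recr n.+1) /=.
by rewrite addr0 subr0 sub0r mulr1 mulrN1 mulNr !mulVKf // addrAC subrr add0r.
Qed.

Lemma reindexed_harmonic (F : fieldType) (m : nat) (a b : F) (n : nat) :
  gen_harmonic_series m a b n = \sum_(k < n) ((k%:R * a + b) ^+ m)^-1.
Proof.
case: n => [|n]; first by rewrite big_ord0.
by rewrite /= /gen_harmonic big_add1 big_mkord.
Qed.

Section Convergents.

Variables (F : fieldType) (m : nat) (a b : F).
Let e (k : nat) : F := (k%:R * a + b) ^+ m.
Let E (n : nat) : F := \prod_(k < n) e k.
Let T (n : nat) : {poly F} := \sum_(k < n) (e k)^-1 *: 'X^(k.+1).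
Let A := harmonic_cf_a m a b.
Let B := harmonic_cf_b m a b.
Hypothesis e_neq0 : forall k, e k != 0.

Lemma harmonic_cf_aE n : A n.+2 = (e n.+1)%:P + (e n)%:P * 'X.
Proof. by rewrite /A /harmonic_cf_a /e subn1 subn2 -mul_polyC. Qed.

Lemma harmonic_cf_bE n : B n.+3 = - (((e n.+1)%:P) ^+ 2 * 'X).
Proof.
by rewrite /B /harmonic_cf_b subn2 mulnC exprM -mul_polyC polyC_exp.
Qed.

Lemma harmonic_cf_b2E : B 2 = - ((e 0)%:P ^+ 2 * ('X * (1 - 'X))).
Proof.
by rewrite /B /harmonic_cf_b /e mul0r add0r mulnC exprM -mul_polyC polyC_exp.
Qed.

Lemma polyC_ES n : (E n.+1)%:P = (E n)%:P * (e n)%:P :> {poly F}.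
Proof. by rewrite -polyCM /E big_ord_recr. Qed.

(** Since [E n.+1 = E n * e n], the two terms of the recurrence carrying [e n ^+ 2 * E n] and an
    extra ['X] cancel. *)
Lemma harmonic_cf_den n : cf_den A B n.+1 = E n.+1 *: (1 - 'X).
Proof.
rewrite /cf_den.
suff [] : (cf_pair A B 0 1 n.+1).2 = E n.+1 *: (1 - 'X) /\
          (cf_pair A B 0 1 n.+2).2 = E n.+2 *: (1 - 'X) by [].
have Q1 : (cf_pair A B 0 1 1).2 = E 1 *: (1 - 'X).
  by rewrite /= mulr1 mulr0 addr0 /E big_ord1 /e mul0r add0r.
elim: n => [|n [IH1 IH2]].
  (* The denominator of index 0 is 1, without the factor [1 - 'X]; the exceptional [B 2] supplies
     it. *)
  split=> //; rewrite cf_pairS Q1 [(cf_pair _ _ _ _ 0).2]/= harmonic_cf_aE harmonic_cf_b2E.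
  rewrite -!mul_polyC !polyC_ES /E big_ord0 polyC1; ring.
split=> //; rewrite cf_pairS IH1 IH2 harmonic_cf_aE harmonic_cf_bE.
rewrite -!mul_polyC !polyC_ES; ring.
Qed.

(** The recurrence of [T] cleared of inverses, so that [ring] can handle it. *)
Lemma polyC_mulTS n : (e n)%:P * T n.+1 = (e n)%:P * T n + 'X^(n.+1).
Proof.
by rewrite /T big_ord_recr /= mulrDr !mul_polyC scalerA divff // scale1r.
Qed.

Lemma harmonic_cf_num n : cf_num A B n = E n *: T n.
Proof.
rewrite /cf_num.
suff [] : (cf_pair A B 1 (A 0%N) n).2 = E n *: T n /\
          (cf_pair A B 1 (A 0%N) n.+1).2 = E n.+1 *: T n.+1 by [].
have P1 : (cf_pair A B 1 (A 0%N) 1).2 = E 1 *: T 1.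
  rewrite /= mulr0 add0r mulr1 /E /T !big_ord1 scalerA divff //.
  by rewrite scale1r.
elim: n => [|n [IH1 IH2]].
  by split=> //; rewrite /T big_ord0 scaler0.
split=> //; rewrite cf_pairS IH1 IH2 harmonic_cf_aE.
(* The extra factor [1 - 'X] of [B 2] is harmless here because [T 0 = 0]. *)
have -> : B n.+2 * (E n *: T n) = - ((e n)%:P ^+ 2 * 'X) * (E n *: T n).
  by case: n {IH1 IH2} => [|n];
    rewrite ?harmonic_cf_bE // /T big_ord0 scaler0 !mulr0.
rewrite -!mul_polyC !polyC_ES.
have -> : (E n)%:P * (e n)%:P * (e n.+1)%:P * T n.+2 =
          (E n)%:P * (e n)%:P * ((e n.+1)%:P * T n.+2) by ring.
rewrite polyC_mulTS [in RHS]exprS.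
(* Eliminating the power of ['X] leaves an identity in which [T n] and [T n.+1] are free. *)
have -> : 'X^(n.+1) = (e n)%:P * T n.+1 - (e n)%:P * T n.
  by rewrite polyC_mulTS addrAC subrr add0r.
ring.
Qed.

Lemma E_neq0 n : E n != 0.
Proof. by apply/prodf_neq0 => k _. Qed.

Lemma coef_T n k : (k < n)%N -> (T n)`_k.+1 = (e k)^-1.
Proof.
move=> kn; rewrite coef_sum (bigD1 (Ordinal kn)) //= coefZ coefXn eqxx mulr1.
rewrite big1 ?addr0 // => i /eqP ik; rewrite coefZ coefXn eqSS.
by case: eqP => [ki|]; [case: ik; apply: val_inj | rewrite mulr0].
Qed.

Lemma coef0_T n : (T n)`_0 = 0.
Proof. by rewrite coef_sum big1 // => i _; rewrite coefZ coefXn mulr0. Qed.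

Lemma harmonic_cf_expansion : has_cf_expansion (gen_harmonic_series m a b) A B.
Proof.
case=> [|n].
  exists (fun=> 0); split; last by case.
  split; first exact: oner_neq0.
  move=> i; rewrite /fps_mul /fps_of_poly coef0.
  by rewrite big1 // => j _; rewrite mulr0.
(* The denominator is [E n.+1 *: (1 - 'X)], so the quotient is given by scaled partial sums of the
   numerator. *)
exists (fun i => (E n.+1)^-1 * \sum_(k < i.+1) (cf_num A B n.+1)`_k); split.
  by rewrite harmonic_cf_den; apply: is_expansion_partial_sums; apply: E_neq0.
move=> i ltin; rewrite reindexed_harmonic harmonic_cf_num.
(* The constant term drops out, so [i] summands remain; as [i <= n.+1], all of them occur in
   [T n.+1]. *)
rewrite big_ord_recl coefZ coef0_T mulr0 add0r mulr_sumr.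
apply: eq_bigr => k _; rewrite /= /bump /= add1n coefZ mulKf ?E_neq0 // coef_T //.
exact: leq_trans (ltn_ord k) ltin.
Qed.

End Convergents.

Theorem theorem5 (R : realType) (m : nat) (a b : R)
    (hm : (1 <= m)%N) (ha : 0 < a) (hb : 0 < b) :
  has_cf_expansion (gen_harmonic_series m a b)
    (harmonic_cf_a m a b) (harmonic_cf_b m a b).
Proof.
apply: harmonic_cf_expansion => k; rewrite expf_neq0 // gt_eqF //.
by rewrite ltr_wpDl // mulr_ge0 // ltW.
Qed.
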